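(* Let $n\ge2$, $d\ge1$, and let $\{\mathcal{P}_k\}_{k\in\mathbb{N}}$ be a sequence of simplicial partitions of the standard simplex $\Delta\subset\mathbb{R}^n$ with $\delta(\mathcal{P}_k)\to0$. Then $$\mathcal{C}_{n,d}=\bigcap_{k\in\mathbb{N}}\mathcal{O}_{n,d}^{\mathcal{P}_k}.$$
   Context: $\mathcal{S}_{n,d}$ is the real vector space of symmetric tensors of order $d$ and dimension $n$ (real arrays invariant under permutations of indices), $\langle\mathcal{A},\mathcal{B}\rangle=\sum_{i_1,\dots,i_d}a_{i_1\cdots i_d}b_{i_1\cdots i_d}$ and $\mathcal{T}_d(\mathbf{x})=\mathbf{x}\otimes\cdots\otimes\mathbf{x}$ ($d$ factors). The copositive cone is $\mathcal{C}_{n,d}=\{\mathcal{A}\in\mathcal{S}_{n,d}:\langle\mathcal{A},\mathcal{T}_d(\mathbf{x})\rangle\ge0\ \forall\mathbf{x}\in\mathbb{R}^n_+\}$. $\Delta=\{\mathbf{x}\in\mathbb{R}^n_+:\|\mathbf{x}\|_1=1\}$. A simplicial partition of $\Delta$ is a finite family $\mathcal{P}=\{\Delta^1,\dots,\Delta^m\}$ of sub-simplices (each the convex hull of $n$ affinely independent points) with $\Delta=\bigcup_i\Delta^i$ and pairwise disjoint (relative) interiors. $V_{\mathcal{P}}$ is the set of all vertices and $E_{\mathcal{P}}$ the set of all edges $\{\mathbf{u},\mathbf{v}\}$ of the simplices in $\mathcal{P}$; $\delta(\mathcal{P})=\max_{\{\mathbf{u},\mathbf{v}\}\in E_{\mathcal{P}}}\|\mathbf{u}-\mathbf{v}\|$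 (Euclidean norm). $\mathcal{O}_{n,d}^{\mathcal{P}}=\{\mathcal{A}\in\mathcal{S}_{n,d}:\langle\mathcal{A},\mathcal{T}_d(\mathbf{v})\rangle\ge0\ \forall\mathbf{v}\in V_{\mathcal{P}}\}$. *)

(* Defs.v *)
(* MathComp / MathComp-Analysis. *)
From HB Require Import structures.
From mathcomp Require Import all_boot all_order all_algebra all_fingroup.
From mathcomp Require Import all_classical all_reals all_analysis.

Set Implicit Arguments.
Unset Strict Implicit.
Unset Printing Implicit Defensive.

Import Order.TTheory GRing.Theory Num.Theory.
Import numFieldNormedType.Exports.

Local Open Scope classical_set_scope.
Local Open Scope ring_scope.

Section Tensors.
Context (R : realType) (n d : nat).

(* The entry a_(i_1 ... i_d) of A is [A i] for the multi-index
   i : {ffun 'I_d -> 'I_n}; [tensor] inherits the pointwise real vector space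
   structure of {ffun _ -> R}. *)
Definition tensor : Type := {ffun {ffun 'I_d -> 'I_n} -> R}.

Definition symmetric_tensor : set tensor :=
  [set A | forall (s : {perm 'I_d}) (i : {ffun 'I_d -> 'I_n}),
     A [ffun k => i (s k)] = A i].

Definition tensor_dot (A B : tensor) : R := \sum_i A i * B i.

Definition tensor_power (x : 'rV[R]_n) : tensor :=
  [ffun i : {ffun 'I_d -> 'I_n} => \prod_(k < d) x 0 (i k)].

End Tensors.

Section Geometry.
Context (R : realType) (n : nat).
Implicit Types (S : set 'rV[R]_n) (x u v : 'rV[R]_n).

Definition nonneg_orthant : set 'rV[R]_n := [set x | forall i, 0 <= x 0 i].

(* The library norm on 'rV[R]_n is the sup norm, hence these two. *)
Definition l1norm x : R := \sum_i `|x 0 i|.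
Definition l2norm x : R := Num.sqrt (\sum_i x 0 i ^+ 2).

Definition std_simplex : set 'rV[R]_n :=
  nonneg_orthant `&` [set x | l1norm x = 1].

Definition affinely_independent m (p : 'I_m -> 'rV[R]_n) : Prop :=
  forall c : 'I_m -> R,
    \sum_i c i = 0 -> \sum_i c i *: p i = 0 -> forall i, c i = 0.

Definition convex_hull m (p : 'I_m -> 'rV[R]_n) : set 'rV[R]_n :=
  [set x | exists c : 'I_m -> R,
     [/\ forall i, 0 <= c i, \sum_i c i = 1 & x = \sum_i c i *: p i]].

Definition affine_hull S : set 'rV[R]_n :=
  [set x | exists m (p : 'I_m -> 'rV[R]_n) (c : 'I_m -> R),
     [/\ forall i, S (p i), \sum_i c i = 1 & x = \sum_i c i *: p i]].

(* Interior of S in the subspace topology of its affine hull. *)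
Definition relative_interior S : set 'rV[R]_n :=
  [set x | S x /\ within (affine_hull S) (nbhs x) S].

Record simplex := Simplex {
  vertex : 'I_n -> 'rV[R]_n;
  vertex_indep : affinely_independent vertex }.

Definition simplex_set (D : simplex) : set 'rV[R]_n := convex_hull (vertex D).

Record simplicial_partition := SimplicialPartition {
  ncells : nat;
  cell : 'I_ncells -> simplex;
  cell_cover : std_simplex = \bigcup_(i in [set: 'I_ncells]) simplex_set (cell i);
  cell_disjoint : forall i j, i != j ->
    relative_interior (simplex_set (cell i)) `&`
    relative_interior (simplex_set (cell j)) = set0 }.

Definition vertices (P : simplicial_partition) : set 'rV[R]_n :=
  [set v | exists (i : 'I_(ncells P)) (a : 'I_n), v = vertex (cell i) a].

(* An edge is an unordered pair {u, v} of distinct vertices of one cell. *)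
Definition edges (P : simplicial_partition) : set (set 'rV[R]_n) :=
  [set e | exists (i : 'I_(ncells P)) (a b : 'I_n),
     a != b /\ e = [set vertex (cell i) a; vertex (cell i) b]].

(* For n >= 2 the set of edges is finite and nonempty, so that this [sup] is
   the maximum edge length. *)
Definition mesh (P : simplicial_partition) : R :=
  sup [set r | exists u v, edges P [set u; v] /\ r = l2norm (u - v)].

End Geometry.

Section Cones.
Context (R : realType) (n d : nat).

Definition copositive_cone : set (tensor R n d) :=
  [set A | symmetric_tensor A /\
     forall x, nonneg_orthant x -> 0 <= tensor_dot A (tensor_power d x)].

Definition outer_cone (P : simplicial_partition R n) : set (tensor R n d) :=
  [set A | symmetric_tensor A /\
     forall v, vertices P v -> 0 <= tensor_dot A (tensor_power d v)].

End Cones.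

Arguments copositive_cone : clear implicits.
Arguments outer_cone {R n} d P.

(* Main.v *)
(* One inclusion is immediate, since the vertices of a partition lie in the
   simplex.  Conversely, A being homogeneous of degree d >= 1 as a form, it
   suffices to test it on the simplex; a point x of the simplex lies in some
   cell of each P_k, hence within mesh (P_k) of any vertex of that cell, so x is
   a limit of vertices and the form is nonnegative at x by continuity. *)
Require Import Defs.
From HB Require Import structures.
From mathcomp Require Import all_boot all_order all_algebra all_fingroup.
From mathcomp Require Import all_classical all_reals all_analysis.
Set Implicit Arguments.
Unset Strict Implicit.
Unset Printing Implicit Defensive.
Import Order.TTheory GRing.Theory Num.Theory.
Import numFieldNormedType.Exports.
Local Open Scope classical_set_scope.
Local Open Scope ring_scope.

Lemma tensor_dot_powerZ (R : realType) (n d : nat) (A : tensor R n d) (a : R)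
    (x : 'rV[R]_n) :
  tensor_dot A (tensor_power d (a *: x)) =
  a ^+ d * tensor_dot A (tensor_power d x).
Proof.
rewrite /tensor_dot mulr_sumr; apply: eq_bigr => i _.
rewrite !ffunE mulrCA; congr (_ * _).
under eq_bigr do rewrite mxE.
by rewrite big_split /= prodr_const card_ord.
Qed.

(** The form is a polynomial in the coordinates, so coordinatewise convergence suffices. *)
Lemma cvg_tensor_dot_power (R : realType) (n d : nat) (A : tensor R n d)
    (v : nat -> 'rV[R]_n) (x : 'rV[R]_n) :
  (forall j, (fun k => v k 0 j) @ \oo --> x 0 j) ->
  (fun k => tensor_dot A (tensor_power d (v k))) @ \oo -->
  tensor_dot A (tensor_power d x).
Proof.
move=> vx; apply: cvg_big => [|i _]; first exact: add_continuous.
apply: cvgM; first exact: cvg_cst.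
rewrite ffunE; under eq_fun do rewrite ffunE.
by apply: cvg_big => [|k _]; [exact: mul_continuous | exact: vx].
Qed.

Lemma normr_coord_le_l2norm (R : realType) (n : nat) (x : 'rV[R]_n) (j : 'I_n) :
  `|x 0 j| <= l2norm x.
Proof.
rewrite -sqrtr_sqr; apply: ler_wsqrtr.
rewrite (bigD1 j) //= lerDl.
by apply: sumr_ge0 => i _; apply: sqr_ge0.
Qed.

Lemma std_simplex_coord_le1 (R : realType) (n : nat) (x : 'rV[R]_n) (j : 'I_n) :
  std_simplex x -> 0 <= x 0 j <= 1.
Proof.
move=> [x0 x1]; rewrite x0 -[X in _ <= X]x1 /l1norm (bigD1 j) //=.
rewrite ger0_norm //= lerDl.
by apply: sumr_ge0.
Qed.

Lemma convex_hull_point (R : realType) (n m : nat) (p : 'I_m -> 'rV[R]_n)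
    (a : 'I_m) : convex_hull p (p a).
Proof.
exists (fun i => (i == a)%:R); split=> [i||]; first exact: ler0n.
- by rewrite (bigD1 a) //= eqxx big1 ?addr0 // => i /negbTE->.
- rewrite (bigD1 a) //= eqxx scale1r big1 ?addr0 // => i /negbTE->.
  by rewrite scale0r.
Qed.

Lemma vertices_std_simplex (R : realType) (n : nat)
    (P : simplicial_partition R n) : vertices P `<=` @std_simplex R n.
Proof.
move=> v [i [a ->]]; rewrite (cell_cover P).
by exists i => //; apply: convex_hull_point.
Qed.

(** As [mesh] is a [sup], the point is that edge lengths are bounded above: all vertices lie in the
    simplex. *)
Lemma edge_le_mesh (R : realType) (n : nat) (P : simplicial_partition R n)
    (i : 'I_(ncells P)) (a b : 'I_n) : a != b ->
  l2norm (vertex (cell i) a - vertex (cell i) b) <= mesh P.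
Proof.
move=> ab; apply: ub_le_sup; last first.
  exists (vertex (cell i) a), (vertex (cell i) b); split=> //.
  by exists i, a, b.
(* The bound is the square root of [n], since coordinates in [0, 1] differ by at most 1. *)
exists (Num.sqrt (\sum_(j < n) 1)) => _ [u [v [[k [p [q [_ e]]]] ->]]].
(* Edges are unordered: [e] only equates two sets, so [u] and [v] are handled through membership. *)
have inS w : [set u; v] w -> std_simplex w.
  by rewrite e => -[->|->]; apply: vertices_std_simplex; do 2 eexists.
apply: ler_wsqrtr; apply: ler_sum => j _; rewrite !mxE.
have /andP[u0 u1] := std_simplex_coord_le1 j (inS u (or_introl erefl)).
have /andP[v0 v1] := std_simplex_coord_le1 j (inS v (or_intror erefl)).
rewrite -real_normK ?num_real // expr_le1 // ler_norml.
by rewrite lerBrDr lerBlDr (le_trans _ u0) ?ler_wpDr // addrC subr_le0.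
Qed.

Lemma vertex_dist_le_mesh (R : realType) (n : nat)
    (P : simplicial_partition R n) (i : 'I_(ncells P)) (a b j : 'I_n) :
  (2 <= n)%N ->
  `|vertex (cell i) a 0 j - vertex (cell i) b 0 j| <= mesh P.
Proof.
move=> n2; have neq_le (p q : 'I_n) : p != q ->
    `|vertex (cell i) p 0 j - vertex (cell i) q 0 j| <= mesh P.
  move=> /(edge_le_mesh (P := P) i); apply: le_trans.
  by have := normr_coord_le_l2norm (vertex (cell i) p - vertex (cell i) q) j;
    rewrite !mxE.
have [->|/neq_le//] := eqVneq a b.
(* For [a = b] the claim is [0 <= mesh P]; a genuine edge from [b], available as [2 <= n], gives
   it. *)
have [c cb] : exists c : 'I_n, c != b.
  have /card_gt0P[c] : (0 < #|predC1 b|)%N.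
    by rewrite cardC1 card_ord -ltnS prednK // ltnW.
  by exists c.
by rewrite subrr normr0; apply: le_trans (neq_le _ _ cb).
Qed.

(** Any vertex [v] of a cell containing [x] works: [x - v] is a convex combination of differences of
    vertices of that cell. *)
Lemma vertex_near (R : realType) (n : nat) (P : simplicial_partition R n)
    (x : 'rV[R]_n) : (2 <= n)%N -> std_simplex x ->
  exists2 v, vertices P v & forall j, `|x 0 j - v 0 j| <= mesh P.
Proof.
move=> n2; rewrite (cell_cover P) => -[i _ [c [c0 c1 ->]]].
pose a : 'I_n := Ordinal (ltnW n2).
exists (vertex (cell i) a) => [|j]; first by exists i, a.
(* The weights sum to 1, so [v] can be moved under the sum; the same trick then spreads [mesh P]
   over the weights. *)
rewrite summxE -[X in _ - X]mul1r -c1 mulr_suml -sumrB.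
apply: le_trans (ler_norm_sum _ _ _) _.
rewrite -[leRHS]mul1r -c1 mulr_suml; apply: ler_sum => k _.
rewrite mxE -mulrBr normrM ger0_norm //.
by apply: ler_wpM2l => //; apply: vertex_dist_le_mesh.
Qed.

Theorem theorem7 (R : realType) (n d : nat) (hn : (2 <= n)%N) (hd : (1 <= d)%N)
  (P : nat -> simplicial_partition R n)
  (hP : (fun k : nat => mesh (P k)) @ \oo --> (0 : R)) :
  copositive_cone R n d = \bigcap_(k in [set: nat]) outer_cone d (P k).
Proof.
apply/seteqP; split=> A => [[symA posA] k _|outA].
  by split=> // v /vertices_std_simplex[v0 _]; apply: posA.
split=> [|x x0]; first by case: (outA 0%N I).
have simplexA y : std_simplex y -> 0 <= tensor_dot A (tensor_power d y).
  move=> yS.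
  have /choice[v vP] k : exists v, vertices (P k) v /\
      forall j, `|y 0 j - v 0 j| <= mesh (P k).
    by have [v] := vertex_near (P k) hn yS; exists v.
  have vy j : (fun k => v k 0 j) @ \oo --> y 0 j.
    apply/cvgrPdist_le => e e0; near=> k.
    apply: le_trans ((vP k).2 j) _; near: k.
    exact: cvgr_le hP _ e0.
  (* The values at the chosen vertices are nonnegative and the half-line is closed, so their limit
     is nonnegative. *)
  refine (closed_cvg (fun z : R => 0 <= z) _ _ _
    (cvg_tensor_dot_power (A := A) vy)).
    exact: closed_ge.
  by apply: nearW => k; apply: (outA k I).2; apply: (vP k).1.
have t0 : 0 <= l1norm x by apply: sumr_ge0.
have [tx|tx] := eqVneq (l1norm x) 0.
  (* Written as a multiple so that homogeneity applies; the factor [0 ^+ d] vanishes because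
     [1 <= d]. *)
  have -> : x = 0 *: 0.
    rewrite scale0r; apply/rowP => j; rewrite mxE; apply/normr0_eq0.
    by apply: (psumr_eq0P _ tx).
  by rewrite tensor_dot_powerZ expr0n gtn_eqF // mul0r.
(* Otherwise [x] is [l1norm x] times its normalization, a point of the simplex. *)
rewrite -[x](scalerKV tx) tensor_dot_powerZ mulr_ge0 ?exprn_ge0 //.
apply: simplexA; split=> [j|]; first by rewrite mxE mulr_ge0 ?invr_ge0.
rewrite /= -[RHS](mulVf tx) {1 3}/l1norm mulr_sumr; apply: eq_bigr => j _.
by rewrite mxE normrM ger0_norm ?invr_ge0.
Unshelve. all: by end_near. Qed.
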